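(* If $\pi$ is a normal form proof of $\vdash \phi$ in $\mathsf{LNGL}$, then $\pi$ can be transformed into a proof of $\vdash \phi$ in $\mathsf{GL_{seq}}$.
   Context: Formulae are built from atoms by $\neg,\lor,\Box$. A linear nested sequent is $\Gamma_{1} \vdash \Delta_{1} \mathbin{/\!/} \cdots \mathbin{/\!/} \Gamma_{n} \vdash \Delta_{n}$ with formula multisets $\Gamma_i,\Delta_i$. The calculus $\mathsf{LNGL}$ has rules ($\mathcal{G}$ a possibly empty prefix): $\mathsf{id_1}$: $\mathcal{G} \mathbin{/\!/} \Gamma, p \vdash p, \Delta$; $\mathsf{id_2}$: $\mathcal{G} \mathbin{/\!/} \Gamma, \Box\phi \vdash \Box\phi, \Delta$; local rules $\lor\mathsf{L}$: from $\mathcal{G} \mathbin{/\!/} \Gamma, \phi \vdash \Delta$ and $\mathcal{G} \mathbin{/\!/} \Gamma, \psi \vdash \Delta$ infer $\mathcal{G} \mathbin{/\!/} \Gamma, \phi\lor\psi \vdash \Delta$; $\lor\mathsf{R}$: from $\mathcal{G} \mathbin{/\!/} \Gamma \vdash \phi,\psi,\Delta$ infer $\mathcal{G} \mathbin{/\!/} \Gamma \vdash \phi\lor\psi,\Delta$; $\neg\mathsf{L}$: from $\mathcal{G} \mathbin{/\!/} \Gamma \vdash \phi,\Delta$ infer $\mathcal{G} \mathbin{/\!/} \Gamma,\neg\phi \vdash \Delta$; $\neg\mathsf{R}$: from $\mathcal{G} \mathbin{/\!/} \Gamma,\phi \vdash \Delta$ infer $\mathcal{G} \mathbin{/\!/}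 \Gamma \vdash \neg\phi,\Delta$; $\mathsf{4L}$: from $\mathcal{G} \mathbin{/\!/} \Gamma,\Box\phi \vdash \Delta \mathbin{/\!/} \Sigma,\Box\phi \vdash \Pi$ infer $\mathcal{G} \mathbin{/\!/} \Gamma,\Box\phi \vdash \Delta \mathbin{/\!/} \Sigma \vdash \Pi$; $\Box\mathsf{L}$: from $\mathcal{G} \mathbin{/\!/} \Gamma,\Box\phi \vdash \Delta \mathbin{/\!/} \Sigma,\phi \vdash \Pi$ infer $\mathcal{G} \mathbin{/\!/} \Gamma,\Box\phi \vdash \Delta \mathbin{/\!/} \Sigma \vdash \Pi$; $\Box\mathsf{R}$: from $\mathcal{G} \mathbin{/\!/} \Gamma \vdash \Delta \mathbin{/\!/} \Box\phi \vdash \phi$ infer $\mathcal{G} \mathbin{/\!/} \Gamma \vdash \Box\phi,\Delta$. An $\mathsf{LNGL}$ proof is in normal form iff, reading bottom-up, each $\Box\mathsf{R}$ application's premise is derived by a block (derivation using only the given rules) of $\mathsf{4L}$ rules, whose premise is derived by a block of $\Box\mathsf{L}$ rules, whose premise is derived by a block of local rules ($\neg\mathsf{L},\neg\mathsf{R},\lor\mathsf{L},\lor\mathsf{R}$). The Gentzen calculus $\mathsf{GL_{seq}}$ (a variant of Sambin and Valentini's calculus) operates on sequents $\Gamma \vdash \Delta$ of formula multisets with rules: $\mathsf{id}$: $\Gamma,\phi \vdash \phi,\Delta$; the standard rules $\neg\mathsf{L}$, $\neg\mathsf{R}$, $\lor\mathsf{L}$, $\lor\mathsf{R}$; and $\Box_{\mathsf{GL}}$: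 from $\Box\Gamma,\Gamma,\Box\phi \vdash \phi$ infer $\Sigma,\Box\Gamma \vdash \Box\phi,\Delta$, where $\Box\Gamma$ prefixes $\Box$ to each formula of $\Gamma$. Weakening is admissible in $\mathsf{GL_{seq}}$. *)

(* Defs.v *)
From HB Require Import structures.
From mathcomp Require Import all_boot.
From mathcomp Require Import finmap multiset.

Set Implicit Arguments.
Unset Strict Implicit.
Unset Printing Implicit Defensive.

Local Open Scope mset_scope.

Inductive form (A : Type) : Type :=
| Atom of A
| Neg of form A
| Or of form A & form A
| Box of form A.

(* [{mset form A}] needs a choice structure on formulae; it is transported from
   labelled trees. *)
Fixpoint form_encode (A : Type) (f : form A) : GenTree.tree A :=
  match f with
  | Atom p => GenTree.Leaf p
  | Neg f => GenTree.Node 0 [:: form_encode f]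
  | Or f g => GenTree.Node 1 [:: form_encode f; form_encode g]
  | Box f => GenTree.Node 2 [:: form_encode f]
  end.

Fixpoint form_decode (A : Type) (t : GenTree.tree A) : option (form A) :=
  match t with
  | GenTree.Leaf p => Some (Atom p)
  | GenTree.Node 0 [:: t] => omap (@Neg A) (form_decode t)
  | GenTree.Node 1 [:: t; u] =>
      if form_decode t is Some f then omap (Or f) (form_decode u) else None
  | GenTree.Node 2 [:: t] => omap (@Box A) (form_decode t)
  | _ => None
  end.

Lemma form_encodeK (A : Type) : pcancel (@form_encode A) (@form_decode A).
Proof.
by elim=> [p|f IHf|f IHf g IHg|f IHf] //=; rewrite ?IHf ?IHg.
Qed.

HB.instance Definition _ (A : choiceType) :=
  Choice.copy (form A) (pcan_type (@form_encodeK A)).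

Definition sequent (A : choiceType) : Type :=
  ({mset (form A)} * {mset (form A)})%type.

Notation "G ⊢ D" := (G, D) (at level 75, no associativity) : mset_scope.

(* Components are listed from left to right, so the active end of the linear
   nested sequent, to which the rules apply, is the end of the sequence. *)
Definition lnseq (A : choiceType) : Type := seq (sequent A).

Notation "G ⫽ s" := (rcons G s) (at level 79, left associativity) : mset_scope.

Inductive LNGL (A : choiceType) : lnseq A -> Type :=
| LN_id1 (G : lnseq A) (Γ Δ : {mset (form A)}) (p : A) :
    LNGL (G ⫽ (Atom p +` Γ ⊢ Atom p +` Δ))
| LN_id2 (G : lnseq A) (Γ Δ : {mset (form A)}) (φ : form A) :
    LNGL (G ⫽ (Box φ +` Γ ⊢ Box φ +` Δ))
| LN_orL (G : lnseq A) (Γ Δ : {mset (form A)}) (φ ψ : form A) :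
    LNGL (G ⫽ (φ +` Γ ⊢ Δ)) ->
    LNGL (G ⫽ (ψ +` Γ ⊢ Δ)) ->
    LNGL (G ⫽ (Or φ ψ +` Γ ⊢ Δ))
| LN_orR (G : lnseq A) (Γ Δ : {mset (form A)}) (φ ψ : form A) :
    LNGL (G ⫽ (Γ ⊢ φ +` (ψ +` Δ))) ->
    LNGL (G ⫽ (Γ ⊢ Or φ ψ +` Δ))
| LN_negL (G : lnseq A) (Γ Δ : {mset (form A)}) (φ : form A) :
    LNGL (G ⫽ (Γ ⊢ φ +` Δ)) ->
    LNGL (G ⫽ (Neg φ +` Γ ⊢ Δ))
| LN_negR (G : lnseq A) (Γ Δ : {mset (form A)}) (φ : form A) :
    LNGL (G ⫽ (φ +` Γ ⊢ Δ)) ->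
    LNGL (G ⫽ (Γ ⊢ Neg φ +` Δ))
| LN_4L (G : lnseq A) (Γ Δ Σ Π : {mset (form A)}) (φ : form A) :
    LNGL (G ⫽ (Box φ +` Γ ⊢ Δ) ⫽ (Box φ +` Σ ⊢ Π)) ->
    LNGL (G ⫽ (Box φ +` Γ ⊢ Δ) ⫽ (Σ ⊢ Π))
| LN_boxL (G : lnseq A) (Γ Δ Σ Π : {mset (form A)}) (φ : form A) :
    LNGL (G ⫽ (Box φ +` Γ ⊢ Δ) ⫽ (φ +` Σ ⊢ Π)) ->
    LNGL (G ⫽ (Box φ +` Γ ⊢ Δ) ⫽ (Σ ⊢ Π))
| LN_boxR (G : lnseq A) (Γ Δ : {mset (form A)}) (φ : form A) :
    LNGL (G ⫽ (Γ ⊢ Δ) ⫽ ([mset Box φ] ⊢ [mset φ])) ->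
    LNGL (G ⫽ (Γ ⊢ Box φ +` Δ)).

Inductive LNGL_rule : Type :=
  R_id1 | R_id2 | R_orL | R_orR | R_negL | R_negR | R_4L | R_boxL | R_boxR.

Definition last_rule (A : choiceType) (S : lnseq A) (π : LNGL S) : LNGL_rule :=
  match π with
  | LN_id1 _ _ _ _ => R_id1
  | LN_id2 _ _ _ _ => R_id2
  | LN_orL _ _ _ _ _ _ _ => R_orL
  | LN_orR _ _ _ _ _ _ => R_orR
  | LN_negL _ _ _ _ _ => R_negL
  | LN_negR _ _ _ _ _ => R_negR
  | LN_4L _ _ _ _ _ _ _ => R_4L
  | LN_boxL _ _ _ _ _ _ _ => R_boxL
  | LN_boxR _ _ _ _ _ => R_boxR
  end.

Definition rule_4L (r : LNGL_rule) : bool :=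
  if r is R_4L then true else false.

Definition rule_boxL (r : LNGL_rule) : bool :=
  if r is R_boxL then true else false.

Definition rule_local (r : LNGL_rule) : bool :=
  match r with R_negL | R_negR | R_orL | R_orR => true | _ => false end.

Definition rule_id_or_boxR (r : LNGL_rule) : bool :=
  match r with R_id1 | R_id2 | R_boxR => true | _ => false end.

(* The conclusion of [π] is derived by a (possibly empty) block of rules from
   [R], and the subproof of [π] above each premise of the block satisfies
   [P]. *)
Fixpoint by_block (A : choiceType) (R : pred LNGL_rule)
    (P : forall S : lnseq A, LNGL S -> bool)
    (S : lnseq A) (π : LNGL S) : bool :=
  P S π ||
  R (last_rule π) &&
  match π with
  | LN_id1 _ _ _ _ | LN_id2 _ _ _ _ => true
  | LN_orL _ _ _ _ _ π1 π2 => by_block R P π1 && by_block R P π2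
  | LN_orR _ _ _ _ _ π1 => by_block R P π1
  | LN_negL _ _ _ _ π1 => by_block R P π1
  | LN_negR _ _ _ _ π1 => by_block R P π1
  | LN_4L _ _ _ _ _ _ π1 => by_block R P π1
  | LN_boxL _ _ _ _ _ _ π1 => by_block R P π1
  | LN_boxR _ _ _ _ π1 => by_block R P π1
  end.

(* The local block ends at initial sequents and at conclusions of further
   box-right applications; without this requirement empty blocks would make
   the condition vacuous. *)
Definition boxR_premise_normal (A : choiceType) (S : lnseq A) (π : LNGL S) :
    bool :=
  by_block rule_4L
    (by_block rule_boxL
      (by_block rule_local (fun S π' => rule_id_or_boxR (last_rule π')))) π.

Fixpoint normal_form (A : choiceType) (S : lnseq A) (π : LNGL S) : bool :=
  match π with
  | LN_id1 _ _ _ _ | LN_id2 _ _ _ _ => true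
  | LN_orL _ _ _ _ _ π1 π2 => normal_form π1 && normal_form π2
  | LN_orR _ _ _ _ _ π1 => normal_form π1
  | LN_negL _ _ _ _ π1 => normal_form π1
  | LN_negR _ _ _ _ π1 => normal_form π1
  | LN_4L _ _ _ _ _ _ π1 => normal_form π1
  | LN_boxL _ _ _ _ _ _ π1 => normal_form π1
  | LN_boxR _ _ _ _ π1 => boxR_premise_normal π1 && normal_form π1
  end.

Definition mbox (A : choiceType) (Γ : {mset (form A)}) : {mset (form A)} :=
  seq_mset [seq Box φ | φ <- (Γ : seq (form A))].

Inductive GLseq (A : choiceType) : sequent A -> Type :=
| GL_id (Γ Δ : {mset (form A)}) (φ : form A) :
    GLseq (φ +` Γ ⊢ φ +` Δ)
| GL_orL (Γ Δ : {mset (form A)}) (φ ψ : form A) :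
    GLseq (φ +` Γ ⊢ Δ) ->
    GLseq (ψ +` Γ ⊢ Δ) ->
    GLseq (Or φ ψ +` Γ ⊢ Δ)
| GL_orR (Γ Δ : {mset (form A)}) (φ ψ : form A) :
    GLseq (Γ ⊢ φ +` (ψ +` Δ)) ->
    GLseq (Γ ⊢ Or φ ψ +` Δ)
| GL_negL (Γ Δ : {mset (form A)}) (φ : form A) :
    GLseq (Γ ⊢ φ +` Δ) ->
    GLseq (Neg φ +` Γ ⊢ Δ)
| GL_negR (Γ Δ : {mset (form A)}) (φ : form A) :
    GLseq (φ +` Γ ⊢ Δ) ->
    GLseq (Γ ⊢ Neg φ +` Δ)
| GL_box (Γ Σ Δ : {mset (form A)}) (φ : form A) :
    GLseq (mbox Γ `+` Γ `+` [mset Box φ] ⊢ [mset φ]) ->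
    GLseq (Σ `+` mbox Γ ⊢ Box φ +` Δ).

(* Main.v *)
(** In a linear nested sequent only the last two components interact: every
    rule acts on the last one, reading off at most boxed formulae of the one
    before it.  So a derivation of [G ⫽ (Γ ⊢ Δ) ⫽ (Σ ⊢ Π)] is translated,
    rule by rule, to a derivation of [Θ, □Θ, Σ ⊢ Π], where [□Θ] collects the
    boxed formulae of [Γ].  Then 4L and □L become contractions against [□Θ] and
    [Θ], while the premise of □R becomes the premise of the GL box rule.  What
    remains is admissibility of contraction in the Gentzen calculus: for
    negations and disjunctions it follows from invertibility by induction on
    the formula, and for atoms and boxes by induction on the derivation. *)
Require Import Defs.
From mathcomp Require Import all_boot.
From mathcomp Require Import finmap multiset.
From mathcomp Require Import zify.

Local Open Scope mset_scope.

Ltac mset_ac := by apply/msetP => ?; rewrite /= ?msetE2; lia.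

(** * Decomposition of multisets *)

(** Compares the principal formula of a rule with a tracked one. The alternatives are informative
    because derivations live in [Type]. *)
Lemma mset1D_mset1D (K : choiceType) (a b : K) (X Y : {mset K}) :
  a +` X = b +` Y ->
  (a = b) * (X = Y) + {Z | X = b +` Z & Y = a +` Z}.
Proof.
move=> e; have [eab|nab] := eqVneq a b.
  by left; split=> //; rewrite -(msetD1K a X) e eab msetD1K.
have bX : b \in X.
  by have := mset1D1 b Y; rewrite -e in_mset1D eq_sym (negPf nab).
right; exists (X `\ b); first by rewrite msetB1K.
by rewrite -(msetD1K b Y) -e -{1}(msetB1K bX) msetDCA msetD1K.
Qed.

(** Serves the box rule, whose antecedent is a sum: it tells whether a formula sits in the weakened
    part or in the boxed part. *)
Lemma msetD_mset1D (K : choiceType) (a : K) (X Y Z : {mset K}) :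
  X `+` Y = a +` Z ->
  {W | X = a +` W & Z = W `+` Y} + {W | Y = a +` W & Z = X `+` W}.
Proof.
move=> e; have : a \in X `+` Y by rewrite e mset1D1.
case/msetDLVR=> [aX|aY]; [left; exists (X `\ a)|right; exists (Y `\ a)].
- by rewrite msetB1K.
- by rewrite -(msetD1K a Z) -e -{1}(msetB1K aX) -msetDA msetD1K.
- by rewrite msetB1K.
- by rewrite -(msetD1K a Z) -e -{1}(msetB1K aY) msetDCA msetD1K.
Qed.

Definition unbox_form {A : Type} (φ : form A) : option (form A) :=
  if φ is Box ψ then Some ψ else None.

Definition unbox {A : choiceType} (Γ : {mset (form A)}) : {mset (form A)} :=
  seq_mset (pmap unbox_form (Γ : seq (form A))).

Section Boxes.

Variable A : choiceType.
Implicit Types (Γ : {mset (form A)}) (φ ψ : form A).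

Lemma Box_inj : injective (@Box A).
Proof. by move=> φ ψ []. Qed.

Lemma mboxE Γ φ : mbox Γ φ = if φ is Box ψ then Γ ψ else 0.
Proof.
rewrite /mbox mset_seqE count_map; case: φ => [p|φ|φ ψ|φ];
  try by rewrite (eq_count (a2 := pred0)) ?count_pred0.
rewrite -count_mem_mset; apply: eq_count => ψ /=.
exact: (inj_eq Box_inj).
Qed.

Lemma unboxE Γ φ : unbox Γ φ = Γ (Box φ).
Proof.
rewrite /unbox mset_seqE -count_mem_mset.
elim: (Γ : seq _) => //= -[p|ψ|ψ χ|ψ] s IHs /=; rewrite IHs //.
by congr (nat_of_bool _ + _); rewrite (inj_eq Box_inj).
Qed.

Lemma mbox0 : mbox mset0 = mset0 :> {mset (form A)}.
Proof. by apply/msetP => -[p|φ|φ ψ|φ]; rewrite mboxE !mset0E. Qed.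

Lemma mboxD1 Γ φ : mbox (φ +` Γ) = Box φ +` mbox Γ.
Proof.
apply/msetP => -[p|ψ|ψ χ|ψ]; rewrite !mset1DE !mboxE ?mset1DE //.
by rewrite (inj_eq Box_inj).
Qed.

Lemma unbox0 : unbox mset0 = mset0 :> {mset (form A)}.
Proof. by apply/msetP => φ; rewrite unboxE !mset0E. Qed.

Lemma unboxD1 Γ φ : unbox (Box φ +` Γ) = φ +` unbox Γ.
Proof.
by apply/msetP => ψ; rewrite unboxE !mset1DE unboxE (inj_eq Box_inj).
Qed.

(** Brings an arbitrary antecedent into the shape [Σ]+[mbox Θ] of the box rule. The subtraction
    loses nothing, since [mbox (unbox Γ)] consists of the boxed formulae of [Γ]. *)
Lemma mset_unbox_split Γ : Γ = (Γ `\` mbox (unbox Γ)) `+` mbox (unbox Γ).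
Proof.
apply/msetP => -[p|φ|φ ψ|φ]; rewrite !msetE2 mboxE ?unboxE; lia.
Qed.

Lemma mbox_mset1D {Γ Θ φ} : mbox Γ = φ +` Θ ->
  {ψ : form A & {Γ1 | φ = Box ψ & Γ = ψ +` Γ1 /\ Θ = mbox Γ1}}.
Proof.
move=> e; have : φ \in mbox Γ by rewrite e mset1D1.
rewrite in_mset mboxE; case: φ e => // ψ e; rewrite -in_mset => ψΓ.
exists ψ, (Γ `\ ψ) => //; rewrite msetB1K //; split=> //.
by rewrite -(msetD1K (Box ψ) Θ) -e -{1}(msetB1K ψΓ) mboxD1 msetD1K.
Qed.

End Boxes.

(** * Inversion and contraction in the Gentzen calculus *)

Section Gentzen.

Variable A : choiceType.
Implicit Types (Γ Δ Σ Π Θ Ξ : {mset (form A)}) (φ ψ χ : form A).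

Lemma GLseq_cast Γ Γ' Δ Δ' :
  GLseq (Γ ⊢ Δ) -> Γ = Γ' -> Δ = Δ' -> GLseq (Γ' ⊢ Δ').
Proof. by move=> H <- <-. Qed.

Ltac gl_ac H := apply: (GLseq_cast _ _ _ _ H); mset_ac.

(* The inversions are instances with [Θ ⊢ Ξ] a premise of the rule for [χ]. *)
Lemma GLseq_replL χ Θ Ξ :
    unbox_form χ = None ->
    (forall Γ Δ, GLseq (Θ `+` Γ ⊢ Ξ `+` (χ +` Δ))) ->
    (forall φ ψ Γ Δ, χ = Or φ ψ ->
      GLseq (φ +` Γ ⊢ Δ) -> GLseq (ψ +` Γ ⊢ Δ) -> GLseq (Θ `+` Γ ⊢ Ξ `+` Δ)) ->
    (forall φ Γ Δ, χ = Neg φ ->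
      GLseq (Γ ⊢ φ +` Δ) -> GLseq (Θ `+` Γ ⊢ Ξ `+` Δ)) ->
  forall Γ Δ, GLseq (χ +` Γ ⊢ Δ) -> GLseq (Θ `+` Γ ⊢ Ξ `+` Δ).
Proof.
move=> nbox Hid Hor Hneg Γ Δ D.
suff: forall s, GLseq s -> forall Γ, s.1 = χ +` Γ ->
    GLseq (Θ `+` Γ ⊢ Ξ `+` s.2) by move/(_ _ D); apply.
move=> {D Γ Δ} s; elim=> {s}
  [Γ Δ φ|Γ Δ φ ψ D1 IH1 D2 IH2|Γ Δ φ ψ D1 IH1|Γ Δ φ D1 IH1|Γ Δ φ D1 IH1
  |Γ Σ Δ φ D1 _] X /=.
- move=> /mset1D_mset1D [[-> <-]|[Z eZ ->]]; first exact: Hid.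
  by gl_ac (GL_id (Θ `+` Z) (Ξ `+` Δ) φ).
- move=> /mset1D_mset1D [[e <-]|[Z eZ ->]]; first exact: (Hor φ ψ).
  have E1 := IH1 (φ +` Z); have E2 := IH2 (ψ +` Z).
  rewrite -[_ `+` (Or _ _ +` _)]msetDCA; apply: GL_orL.
    by rewrite msetDCA; apply: E1; rewrite /= eZ; mset_ac.
  by rewrite msetDCA; apply: E2; rewrite /= eZ; mset_ac.
- move=> /IH1 E; rewrite [Ξ `+` _]msetDCA; apply: GL_orR; gl_ac E.
- move=> /mset1D_mset1D [[e <-]|[Z eZ ->]]; first exact: (Hneg φ).
  rewrite [Θ `+` _]msetDCA; apply: GL_negL; gl_ac (IH1 _ eZ).
- move=> e; rewrite [Ξ `+` _]msetDCA; apply: GL_negR.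
  by rewrite msetDCA; apply: IH1; rewrite /= e; mset_ac.
(* Not being a box, [χ] can only come from the weakened part, so [Θ] and [Ξ] are weakened in and the
   premise is kept. *)
- case/msetD_mset1D => [[W eW ->]|[W /mbox_mset1D [ψ [Γ1 eχ _]]]]; last first.
    by rewrite eχ in nbox.
  gl_ac (GL_box (Θ `+` W) (Ξ `+` Δ) D1).
Qed.

(** The mirror image for succedents; here [nbox] rules out that [χ] is principal in the box rule. *)
Lemma GLseq_replR χ Θ Ξ :
    unbox_form χ = None ->
    (forall Γ Δ, GLseq (Θ `+` (χ +` Γ) ⊢ Ξ `+` Δ)) ->
    (forall φ ψ Γ Δ, χ = Or φ ψ ->
      GLseq (Γ ⊢ φ +` (ψ +` Δ)) -> GLseq (Θ `+` Γ ⊢ Ξ `+` Δ)) ->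
    (forall φ Γ Δ, χ = Neg φ ->
      GLseq (φ +` Γ ⊢ Δ) -> GLseq (Θ `+` Γ ⊢ Ξ `+` Δ)) ->
  forall Γ Δ, GLseq (Γ ⊢ χ +` Δ) -> GLseq (Θ `+` Γ ⊢ Ξ `+` Δ).
Proof.
move=> nbox Hid Hor Hneg Γ Δ D.
suff: forall s, GLseq s -> forall Δ, s.2 = χ +` Δ ->
    GLseq (Θ `+` s.1 ⊢ Ξ `+` Δ) by move/(_ _ D); apply.
move=> {D Γ Δ} s; elim=> {s}
  [Γ Δ φ|Γ Δ φ ψ D1 IH1 D2 IH2|Γ Δ φ ψ D1 IH1|Γ Δ φ D1 IH1|Γ Δ φ D1 IH1
  |Γ Σ Δ φ D1 _] X /=.
- move=> /mset1D_mset1D [[-> <-]|[Z eZ ->]]; first exact: Hid.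
  by gl_ac (GL_id (Θ `+` Γ) (Ξ `+` Z) φ).
- move=> e; rewrite [Θ `+` _]msetDCA; apply: GL_orL.
    by gl_ac (IH1 _ e).
  by gl_ac (IH2 _ e).
- move=> /mset1D_mset1D [[e <-]|[Z eZ ->]]; first exact: (Hor φ ψ).
  rewrite [Ξ `+` _]msetDCA; apply: GL_orR.
  have E : φ +` (ψ +` Δ) = χ +` (φ +` (ψ +` Z)) by rewrite eZ; mset_ac.
  gl_ac (IH1 _ E).
- move=> e; rewrite [Θ `+` _]msetDCA; apply: GL_negL.
  have E : φ +` Δ = χ +` (φ +` X) by rewrite e; mset_ac.
  gl_ac (IH1 _ E).
- move=> /mset1D_mset1D [[e <-]|[Z eZ ->]]; first exact: (Hneg φ).
  rewrite [Ξ `+` _]msetDCA; apply: GL_negR; gl_ac (IH1 _ eZ).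
- move=> /mset1D_mset1D [[e _]|[Z _ ->]]; first by rewrite -e in nbox.
  gl_ac (GL_box (Θ `+` Σ) (Ξ `+` Z) D1).
Qed.

Lemma GLseq_orL_inv1 φ ψ Γ Δ : GLseq (Or φ ψ +` Γ ⊢ Δ) -> GLseq (φ +` Γ ⊢ Δ).
Proof.
move=> D; rewrite -[Δ]mset0D; apply: GLseq_replL D => //.
(* The identity rule takes compound formulae, so an initial sequent on the disjunction is re-derived
   by decomposing its right copy. *)
- move=> {}Γ {}Δ; rewrite mset0D; apply: GL_orR; exact: GL_id.
- by move=> φ' ψ' {}Γ {}Δ [<- <-] D _; rewrite mset0D.
Qed.

Lemma GLseq_orL_inv2 φ ψ Γ Δ : GLseq (Or φ ψ +` Γ ⊢ Δ) -> GLseq (ψ +` Γ ⊢ Δ).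
Proof.
move=> D; rewrite -[Δ]mset0D; apply: GLseq_replL D => //.
- move=> {}Γ {}Δ; rewrite mset0D; apply: GL_orR; rewrite msetDCA; exact: GL_id.
- by move=> φ' ψ' {}Γ {}Δ [<- <-] _ D; rewrite mset0D.
Qed.

Lemma GLseq_orR_inv φ ψ Γ Δ :
  GLseq (Γ ⊢ Or φ ψ +` Δ) -> GLseq (Γ ⊢ φ +` (ψ +` Δ)).
Proof.
move=> D; rewrite -[Γ]mset0D msetDA; apply: GLseq_replR D => //.
- move=> {}Γ {}Δ; rewrite mset0D -msetDA; apply: GL_orL; first exact: GL_id.
  rewrite [φ +` _]msetDCA; exact: GL_id.
- by move=> φ' ψ' {}Γ {}Δ [<- <-] D; rewrite mset0D -msetDA.
Qed.

Lemma GLseq_negL_inv φ Γ Δ : GLseq (Neg φ +` Γ ⊢ Δ) -> GLseq (Γ ⊢ φ +` Δ).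
Proof.
move=> D; rewrite -[Γ]mset0D; apply: GLseq_replL D => //.
- move=> {}Γ {}Δ; rewrite mset0D msetDCA; apply: GL_negR; exact: GL_id.
- by move=> φ' {}Γ {}Δ [<-] D; rewrite mset0D.
Qed.

Lemma GLseq_negR_inv φ Γ Δ : GLseq (Γ ⊢ Neg φ +` Δ) -> GLseq (φ +` Γ ⊢ Δ).
Proof.
move=> D; rewrite -[Δ]mset0D; apply: GLseq_replR D => //.
- move=> {}Γ {}Δ; rewrite mset0D msetDCA; apply: GL_negL; exact: GL_id.
- by move=> φ' {}Γ {}Δ [<-] D; rewrite mset0D.
Qed.

Definition contractibleL χ :=
  forall Γ Δ, GLseq (χ +` (χ +` Γ) ⊢ Δ) -> GLseq (χ +` Γ ⊢ Δ).

Definition contractibleR χ :=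
  forall Γ Δ, GLseq (Γ ⊢ χ +` (χ +` Δ)) -> GLseq (Γ ⊢ χ +` Δ).

(** These are the formulae that no local rule decomposes, so inversion cannot reduce their
    contraction to subformulae. *)
Definition nonlocal χ : bool :=
  match χ with Atom _ | Box _ => true | _ => false end.

(** Induction on the derivation. Local rules never act on [χ], and a copy in the weakened part of a
    box rule is simply dropped. *)
Lemma contractibleL_nonlocal χ :
  nonlocal χ -> (forall ψ, χ = Box ψ -> contractibleL ψ) -> contractibleL χ.
Proof.
move=> nl Hbox Γ Δ D.
suff: forall s, GLseq s -> forall Γ, s.1 = χ +` (χ +` Γ) ->
    GLseq (χ +` Γ ⊢ s.2) by move/(_ _ D); apply.
move=> {D Γ Δ} s; elim=> {s}
  [Γ Δ φ|Γ Δ φ ψ D1 IH1 D2 IH2|Γ Δ φ ψ D1 IH1|Γ Δ φ D1 IH1|Γ Δ φ D1 IH1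
  |Γ Σ Δ φ D1 IH1] X /=.
- move=> /mset1D_mset1D [[-> _]|[Z _ ->]]; exact: GL_id.
- move=> /mset1D_mset1D [[e _]|[Z eZ /mset1D_mset1D [[e _]|[W -> eW]]]].
    by rewrite -e in nl.
    by rewrite e in nl.
  rewrite [χ +` _]msetDCA; apply: GL_orL; rewrite msetDCA.
    by apply: IH1; rewrite /= eZ eW; mset_ac.
  by apply: IH2; rewrite /= eZ eW; mset_ac.
- by move=> /IH1 E; apply: GL_orR.
- move=> /mset1D_mset1D [[e _]|[Z eZ /mset1D_mset1D [[e _]|[W -> eW]]]].
    by rewrite -e in nl.
    by rewrite e in nl.
  rewrite [χ +` _]msetDCA; apply: GL_negL.
  by apply: IH1; rewrite /= eZ eW.
- move=> e; apply: GL_negR; rewrite msetDCA.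
  by apply: IH1; rewrite /= e; mset_ac.
- case/msetD_mset1D => [[W eW e]|[W /mbox_mset1D [ψ [Γ1 eχ [eΓ eW]]] e]].
    by rewrite e; exact: GL_box.
  rewrite {}eW {}eΓ {}eχ in e D1 IH1 nl Hbox *.
  case/msetD_mset1D: (esym e) =>
    [[V eV ->]|[V /mbox_mset1D [ψ' [Γ2 [<-] [eΓ eV]]] ->]].
    rewrite msetDCA -mboxD1; exact: GL_box.
  rewrite {}eV {}eΓ in e IH1 *; rewrite msetDCA -mboxD1; apply: GL_box.
  (* Both copies of [Box ψ] are principal, so the premise contains [Box ψ] and [ψ] twice each: the
     induction hypothesis contracts the former, [Hbox] the latter. *)
  have {}IH1 := IH1 (mbox Γ2 `+` (ψ +` (ψ +` Γ2)) `+` [mset Box φ]).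
  have E : GLseq (ψ +` (ψ +` (mbox (ψ +` Γ2) `+` Γ2 `+` [mset Box φ])) ⊢ [mset φ]).
    rewrite mboxD1; apply: GLseq_cast (IH1 _) _ _; rewrite /= ?mboxD1; mset_ac.
  gl_ac (Hbox ψ erefl _ _ E).
Qed.

Lemma contractibleR_nonlocal χ : nonlocal χ -> contractibleR χ.
Proof.
move=> nl Γ Δ D.
suff: forall s, GLseq s -> forall Δ, s.2 = χ +` (χ +` Δ) ->
    GLseq (s.1 ⊢ χ +` Δ) by move/(_ _ D); apply.
move=> {D Γ Δ} s; elim=> {s}
  [Γ Δ φ|Γ Δ φ ψ D1 IH1 D2 IH2|Γ Δ φ ψ D1 IH1|Γ Δ φ D1 IH1|Γ Δ φ D1 IH1
  |Γ Σ Δ φ D1 IH1] X /=.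
- move=> /mset1D_mset1D [[-> _]|[Z _ ->]]; exact: GL_id.
- by move=> e; apply: GL_orL; [apply: IH1|apply: IH2].
- move=> /mset1D_mset1D [[e _]|[Z eZ /mset1D_mset1D [[e _]|[W -> eW]]]].
    by rewrite -e in nl.
    by rewrite e in nl.
  rewrite [χ +` _]msetDCA; apply: GL_orR.
  have E : φ +` (ψ +` Δ) = χ +` (χ +` (φ +` (ψ +` W))) by rewrite eZ eW; mset_ac.
  gl_ac (IH1 _ E).
- move=> e; apply: GL_negL; rewrite msetDCA.
  by apply: IH1; rewrite /= e; mset_ac.
- move=> /mset1D_mset1D [[e _]|[Z eZ /mset1D_mset1D [[e _]|[W -> eW]]]].
    by rewrite -e in nl.
    by rewrite e in nl.
  rewrite [χ +` _]msetDCA; apply: GL_negR.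
  by apply: IH1; rewrite /= eZ eW.
- by move=> /mset1D_mset1D [[<- _]|[Z _ ->]]; apply: GL_box.
Qed.

(** Both sides go together because negation moves its argument across the turnstile. *)
Lemma GLseq_contract χ : contractibleL χ * contractibleR χ.
Proof.
elim: χ => [p|φ [IHL IHR]|φ [IHL1 IHR1] ψ [IHL2 IHR2]|φ [IHL IHR]].
- by split; [apply: contractibleL_nonlocal|apply: contractibleR_nonlocal].
- split=> Γ Δ D.
    exact/GL_negL/IHR/GLseq_negL_inv/GLseq_negL_inv.
  exact/GL_negR/IHL/GLseq_negR_inv/GLseq_negR_inv.
- split=> Γ Δ D.
    apply: GL_orL.
      apply/IHL1/(GLseq_orL_inv1 _ ψ).
      by gl_ac (GLseq_orL_inv1 _ _ _ _ D).
    apply/IHL2/(GLseq_orL_inv2 φ).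
    by gl_ac (GLseq_orL_inv2 _ _ _ _ D).
  apply/GL_orR/IHR1.
  have E : GLseq (Γ ⊢ Or φ ψ +` (φ +` (ψ +` Δ))).
    gl_ac (GLseq_orR_inv _ _ _ _ D).
  have {}E : GLseq (Γ ⊢ ψ +` (ψ +` (φ +` (φ +` Δ)))).
    gl_ac (GLseq_orR_inv _ _ _ _ E).
  gl_ac (IHR2 _ _ E).
- split; last exact: contractibleR_nonlocal.
  by apply: contractibleL_nonlocal => // ψ [<-].
Qed.

End Gentzen.

(** * Translation of linear nested derivations *)

(** The sum matches the context of the premise of [GL_box]. The default of [last] makes the context
    empty for an empty prefix. *)
Definition box_context {A : choiceType} (G : lnseq A) : {mset (form A)} :=
  let Θ := unbox (last (mset0 ⊢ mset0) G).1 in mbox Θ `+` Θ.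

(** Exhibits the copies of [Box φ] and [φ] against which the formulae added by 4L and □L are
    contracted. *)
Lemma box_context_rcons (A : choiceType) (G : lnseq A) (Γ Δ : {mset (form A)}) φ :
  box_context (G ⫽ (Box φ +` Γ ⊢ Δ)) =
    Box φ +` (φ +` box_context (G ⫽ (Γ ⊢ Δ))).
Proof. by rewrite /box_context !last_rcons /= unboxD1 mboxD1; mset_ac. Qed.

Lemma LNGL_GLseq (A : choiceType) (G : lnseq A) (s : sequent A) :
  LNGL (G ⫽ s) -> GLseq (box_context G `+` s.1 ⊢ s.2).
Proof.
move=> π; suff: forall S : lnseq A, LNGL S -> forall G s, S = (G ⫽ s) ->
    GLseq (box_context G `+` s.1 ⊢ s.2) by move/(_ _ π); apply.
move=> {π G s} S; elim=> {S}
  [G Γ Δ p|G Γ Δ φ|G Γ Δ φ ψ _ IH1 _ IH2|G Γ Δ φ ψ _ IH|G Γ Δ φ _ IH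
  |G Γ Δ φ _ IH|G Γ Δ Σ Π φ _ IH|G Γ Δ Σ Π φ _ IH|G Γ Δ φ _ IH] H s /rcons_inj
  [<- <-] /=.
- by rewrite msetDCA; apply: GL_id.
- by rewrite msetDCA; apply: GL_id.
- rewrite msetDCA; apply: GL_orL; rewrite msetDCA; [exact: (IH1 _ _ erefl)|exact: (IH2 _ _ erefl)].
- apply: GL_orR; exact: (IH _ _ erefl).
- rewrite msetDCA; apply: GL_negL; exact: (IH _ _ erefl).
- apply: GL_negR; rewrite msetDCA; exact: (IH _ _ erefl).
- have := IH _ _ erefl; rewrite box_context_rcons /= => D.
  rewrite -msetDA; apply: (GLseq_contract _ _).1.
  by apply: GLseq_cast D _ _; mset_ac.
- have := IH _ _ erefl; rewrite box_context_rcons /= => D.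
  rewrite msetDCA -msetDA; apply: (GLseq_contract _ _).1.
  by apply: GLseq_cast D _ _; mset_ac.
- have := IH _ _ erefl; rewrite {1}/box_context last_rcons /= => D.
  (* [D] is now a premise of [GL_box]; the context of the prefix and the unboxed formulae of [Γ]
     form the weakened part. *)
  by rewrite {1}(mset_unbox_split _ Γ) msetDA; apply: GL_box.
Qed.

Theorem theorem5p2 (A : choiceType) (φ : form A)
    (π : LNGL [:: (mset0 ⊢ [mset φ])]) (Hπ : normal_form π) :
  GLseq (mset0 ⊢ [mset φ]).
Proof.
have := LNGL_GLseq _ [::] _ π.
by rewrite /box_context /= unbox0 mbox0 !mset0D.
Qed.
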